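(* Let $G$ be a group and let $N$ be a $G$-group, i.e. a group with an action $L:G\to\mathrm{Aut}(N)$ of $G$ by automorphisms. Then the $N$-conjugacy classes of splittings of the split extension $$1\to N\to N\rtimes_LG\to G\to1$$ are in one-to-one correspondence with the elements of $H^1(G,{}_LN)$.
   Context: $N\rtimes_LG$ is $N\times G$ with $(n_1,g_1)(n_2,g_2)=(n_1L_{g_1}(n_2),g_1g_2)$. A splitting is a group homomorphism $s:G\to N\rtimes_LG$ with $\pi\circ s=\mathrm{id}_G$, where $\pi(n,g)=g$. Two splittings $s_1,s_2$ are $N$-conjugate if there is $n\in N$ with $s_2(g)=n\,s_1(g)\,n^{-1}$ for all $g\in G$ (with $N$ identified with $N\times\{1\}$). A $1$-cocycle is a function $\gamma:G\to N$ with $\gamma(1)=1$ and $L_a(\gamma(b))\gamma(a)=\gamma(ab)$ for all $a,b\in G$. Two $1$-cocycles $\gamma_1,\gamma_2$ are cohomologous if there is $n\in N$ with $L_g(n)\gamma_1(g)=\gamma_2(g)n$ for all $g\in G$. $H^1(G,{}_LN)$ is the set of classes of cohomologous $1$-cocycles. *)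

(* Defs.v *)
From HB Require Import structures.
From mathcomp Require Import all_boot.
From mathcomp Require Import boolp.

Set Implicit Arguments.
Unset Strict Implicit.
Unset Printing Implicit Defensive.

Notation "{ 'ghom' G -> H }" := (UMagmaMorphism.type G%type H%type)
  (at level 0, G at level 98, H at level 99, format "{ 'ghom'  G  ->  H }")
  : type_scope.

Local Open Scope group_scope.
Local Open Scope quotient_scope.

Lemma ghom_ext (G H : groupType) (f g : {ghom G -> H}) : f =1 g -> f = g.
Proof.
case: f g => [f [[f1] [fM]]] [g [[g1] [gM]]] /= /funext fg.
case: _ / fg g1 gM => g1 gM.
by rewrite (Prop_irrelevance f1 g1) (Prop_irrelevance fM gM).
Qed.

Record aut (N : groupType) : Type := MkAut {
  aut_hom :> {ghom N -> N};
  aut_bij : bijective aut_hom }.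

Section AutGroup.
Variable N : groupType.
Implicit Types f g h : aut N.

Lemma aut_ext f g : f =1 g -> f = g.
Proof.
case: f g => [f bf] [g bg] /= /ghom_ext E.
by case: _ / E bg => bg; rewrite (Prop_irrelevance bf bg).
Qed.

Definition aut_one : aut N := @MkAut N idfun (Bijective (fun=> erefl) (fun=> erefl)).

Definition aut_mul f g : aut N :=
  @MkAut N (f \o g : N -> N) (bij_comp (aut_bij f) (aut_bij g)).

Lemma aut_inv_exists f : exists g, cancel f g /\ cancel g f.
Proof.
have [g fK gK] := aut_bij f.
pose gu := isUMagmaMorphism.Build N N g
  (can2_gmulf1 fK gK, can2_gmulfM fK gK).
pose gm : {ghom N -> N} := HB.pack g gu.
by exists (@MkAut N gm (Bijective gK fK)).
Qed.

Definition aut_inv f : aut N := projT1 (cid (aut_inv_exists f)).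

Lemma aut_invK f : cancel f (aut_inv f).
Proof. by rewrite /aut_inv; case: cid => g []. Qed.

Lemma aut_invVK f : cancel (aut_inv f) f.
Proof. by rewrite /aut_inv; case: cid => g []. Qed.

Lemma aut_mulA : associative aut_mul.
Proof. by move=> f g h; apply: aut_ext. Qed.

Lemma aut_mul1 : left_id aut_one aut_mul.
Proof. by move=> f; apply: aut_ext. Qed.

Lemma aut_mulr1 : right_id aut_one aut_mul.
Proof. by move=> f; apply: aut_ext. Qed.

Lemma aut_mulV : left_inverse aut_one aut_inv aut_mul.
Proof. by move=> f; apply: aut_ext => x; apply: aut_invK. Qed.

Lemma aut_mulrV : right_inverse aut_one aut_inv aut_mul.
Proof. by move=> f; apply: aut_ext => x; apply: aut_invVK. Qed.

HB.instance Definition _ := gen_eqMixin (aut N).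
HB.instance Definition _ := gen_choiceMixin (aut N).
HB.instance Definition _ := isGroup.Build (aut N)
  aut_mulA aut_mul1 aut_mulr1 aut_mulV aut_mulrV.

End AutGroup.

(* [L] does not occur in the body; it is a parameter of the type so that the
   group structure below can depend on it. *)
Definition sdp (G N : groupType) (L : {ghom G -> aut N}) : Type := (N * G)%type.

Section SemidirectProduct.
Variables (G N : groupType) (L : {ghom G -> aut N}).

Implicit Types x y z : sdp L.

Lemma act1 n : L 1 n = n.
Proof. by rewrite gmulf1. Qed.

Lemma actM a b n : L (a * b) n = L a (L b n).
Proof. by rewrite gmulfM. Qed.

Definition sdp_one : sdp L := (1, 1).
Definition sdp_mul x y : sdp L := (x.1 * L x.2 y.1, x.2 * y.2).
Definition sdp_inv x : sdp L := (L x.2^-1 x.1^-1, x.2^-1).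

Lemma sdp_mulA : associative sdp_mul.
Proof. by move=> x y z; rewrite /sdp_mul /= gmulfM actM !mulgA. Qed.

Lemma sdp_mul1 : left_id sdp_one sdp_mul.
Proof. by case=> n g; rewrite /sdp_mul /= act1 !mul1g. Qed.

Lemma sdp_mulr1 : right_id sdp_one sdp_mul.
Proof. by case=> n g; rewrite /sdp_mul /= gmulf1 !mulg1. Qed.

Lemma sdp_mulV : left_inverse sdp_one sdp_inv sdp_mul.
Proof.
by case=> n g; rewrite /sdp_mul /sdp_inv /= -gmulfM !mulVg gmulf1.
Qed.

Lemma sdp_mulrV : right_inverse sdp_one sdp_inv sdp_mul.
Proof.
by case=> n g; rewrite /sdp_mul /sdp_inv /= -actM !mulgV act1 mulgV.
Qed.

HB.instance Definition _ := Choice.on (sdp L).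
HB.instance Definition _ := isGroup.Build (sdp L)
  sdp_mulA sdp_mul1 sdp_mulr1 sdp_mulV sdp_mulrV.

Definition sdp_incl (n : N) : sdp L := (n, 1).
Definition sdp_proj (x : sdp L) : G := x.2.

Lemma sdp_inclM : {morph sdp_incl : m n / m * n}.
Proof.
move=> m n; change ((m * n, 1) = (m * L 1 n, 1 * 1) :> N * G).
by rewrite act1 mulg1.
Qed.

HB.instance Definition _ :=
  isUMagmaMorphism.Build N (sdp L) sdp_incl (erefl, sdp_inclM).

Lemma sdp_projM : {morph sdp_proj : x y / x * y}.
Proof. by []. Qed.

HB.instance Definition _ :=
  isUMagmaMorphism.Build (sdp L) G sdp_proj (erefl, sdp_projM).

End SemidirectProduct.

Section Splittings.
Variables (G N : groupType) (L : {ghom G -> aut N}).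

Record splitting : Type := MkSplitting {
  splitting_hom :> {ghom G -> sdp L};
  splittingP : sdp_proj (L := L) \o splitting_hom =1 id }.

HB.instance Definition _ := gen_eqMixin splitting.
HB.instance Definition _ := gen_choiceMixin splitting.

Definition N_conjugate (s1 s2 : splitting) : Prop :=
  exists n : N, forall g : G, s2 g = sdp_incl L n * s1 g * (sdp_incl L n)^-1.

Definition N_conjugateb : rel splitting := fun s1 s2 => `[< N_conjugate s1 s2 >].

Lemma N_conjugate_equiv : equiv_class_of N_conjugateb.
Proof.
split=> [s|s1 s2|s2 s1 s3].
- by apply/asboolP; exists 1 => g; rewrite gmulf1 mul1g divg1.
- by apply/asbool_equiv_eq; split=> -[n E]; exists n^-1 => g;
    rewrite E gmulfV invgK !mulgA mulVg mul1g mulgVK.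
- move=> /asboolP[m E] /asboolP[n F]; apply/asboolP; exists (n * m) => g.
  by rewrite F E gmulfM invgM !mulgA.
Qed.

Canonical N_conjugate_equivrel := EquivRelPack N_conjugate_equiv.

Definition splitting_classes : Type := {eq_quot N_conjugate_equivrel}.
HB.instance Definition _ := EqQuotient.on splitting_classes.
HB.instance Definition _ := Choice.on splitting_classes.

End Splittings.

Section Cocycles.
Variables (G N : groupType) (L : {ghom G -> aut N}).

Record cocycle : Type := MkCocycle {
  cocycle_fun :> G -> N;
  cocycle1 : cocycle_fun 1 = 1;
  cocycleM : forall a b : G,
    L a (cocycle_fun b) * cocycle_fun a = cocycle_fun (a * b) }.

HB.instance Definition _ := gen_eqMixin cocycle.
HB.instance Definition _ := gen_choiceMixin cocycle.

Definition cohomologous (c1 c2 : cocycle) : Prop :=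
  exists n : N, forall g : G, L g n * c1 g = c2 g * n.

Definition cohomologousb : rel cocycle := fun c1 c2 => `[< cohomologous c1 c2 >].

Lemma cohomologous_equiv : equiv_class_of cohomologousb.
Proof.
have sym c1 c2 : cohomologous c1 c2 -> cohomologous c2 c1.
  by move=> [n E]; exists n^-1 => g; rewrite gmulfV; apply: (mulgI (L g n));
    rewrite mulVKg mulgA E mulgK.
split=> [c|c1 c2|c2 c1 c3].
- by apply/asboolP; exists 1 => g; rewrite gmulf1 mul1g mulg1.
- by apply/asbool_equiv_eq; split; apply: sym.
- move=> /asboolP[m E] /asboolP[n F]; apply/asboolP; exists (n * m) => g.
  by rewrite gmulfM -mulgA E mulgA F mulgA.
Qed.

Canonical cohomologous_equivrel := EquivRelPack cohomologous_equiv.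

Definition H1 : Type := {eq_quot cohomologous_equivrel}.
HB.instance Definition _ := EqQuotient.on H1.
HB.instance Definition _ := Choice.on H1.

End Cocycles.

(* Main.v *)
Require Import Defs.
From HB Require Import structures.
From mathcomp Require Import all_boot.
From mathcomp Require Import boolp.

(** A homomorphic section of the projection has the form [g |-> (u g, g)], and
    multiplicativity in the semidirect product reads [u (a * b) = u a * L a (u b)].
    Taking inverses reverses the order of the factors, so [c g := (u g)^-1]
    satisfies [c (a * b) = L a (c b) * c a], which is the cocycle identity.
    Hence splittings and cocycles correspond bijectively via [c = u^-1]
    ([cocycle_of_splittingK], [splitting_of_cocycleK]).

    Conjugating by [n] replaces [u g] by [n * u g * (L g n)^-1], hence [c g] by
    [L g n * c g * n^-1]: two splittings are conjugate by [n] exactly when their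
    cocycles are cohomologous through the same [n]
    ([cohomologous_cocycle_of_splitting]).  A bijection that preserves and
    reflects the equivalence relations induces a bijection of the quotients
    ([eq_quot_bij]). *)

Set Implicit Arguments.
Unset Strict Implicit.
Unset Printing Implicit Defensive.

Local Open Scope group_scope.
Local Open Scope quotient_scope.

Lemma eq_quot_bij (S T : choiceType) (eS : equiv_rel S) (eT : equiv_rel T)
    (phi : S -> T) (psi : T -> S) :
  cancel phi psi -> cancel psi phi -> {mono phi : x y / eS x y >-> eT x y} ->
  exists f : {eq_quot eS} -> {eq_quot eT}, bijective f.
Proof.
move=> phiK psiK phi_mono.
exists (fun x => \pi_{eq_quot eT} (phi (repr x))).
exists (fun y => \pi_{eq_quot eS} (psi (repr y))).
- move=> x; rewrite -[RHS]reprK; apply/eqmodP.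
  by rewrite -phi_mono psiK; apply/eqmodP; rewrite reprK.
- move=> y; rewrite -[RHS]reprK; apply/eqmodP.
  by rewrite -{2}[repr y]psiK phi_mono; apply/eqmodP; rewrite reprK.
Qed.

Section SplittingsAndCocycles.
Variables (G N : groupType) (L : {ghom G -> aut N}).
Implicit Types (s : splitting L) (c : cocycle L) (x y : sdp L).

Lemma sdp_mulE x y : x * y = (x.1 * L x.2 y.1, x.2 * y.2) :> sdp L.
Proof. by []. Qed.

Lemma splitting_ext s1 s2 : s1 =1 s2 -> s1 = s2.
Proof.
case: s1 s2 => [s1 P1] [s2 P2] /= /ghom_ext E.
by case: _ / E P2 => P2; rewrite (Prop_irrelevance P1 P2).
Qed.

Lemma cocycle_ext c1 c2 : c1 =1 c2 -> c1 = c2.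
Proof.
case: c1 c2 => [c1 c11 c1M] [c2 c21 c2M] /= /funext E.
case: _ / E c21 c2M => c21 c2M.
by rewrite (Prop_irrelevance c11 c21) (Prop_irrelevance c1M c2M).
Qed.

Lemma splitting2 s g : (s g).2 = g.
Proof. exact: (splittingP s g). Qed.

Lemma splitting_eta s g : s g = ((s g).1, g).
Proof. by rewrite -[X in (_, X)](splitting2 s); case: (s g). Qed.

Lemma splitting1M s a b : (s (a * b)).1 = (s a).1 * L a (s b).1.
Proof. by rewrite gmulfM sdp_mulE /= splitting2. Qed.

Lemma cocycle_of_splitting1 s : (s 1).1^-1 = 1.
Proof. by rewrite gmulf1 invg1. Qed.

Lemma cocycle_of_splittingM s a b :
  L a (s b).1^-1 * (s a).1^-1 = (s (a * b)).1^-1.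
Proof. by rewrite splitting1M invgM gmulfV. Qed.

(** The inverse turns the crossed-homomorphism rule of a splitting into the
    order of factors required of a cocycle. *)
Definition cocycle_of_splitting s : cocycle L :=
  MkCocycle (cocycle_of_splitting1 s) (cocycle_of_splittingM s).

Definition section_of_cocycle c (g : G) : sdp L := ((c g)^-1, g).

Lemma section_of_cocycle1 c : section_of_cocycle c 1 = 1.
Proof. by rewrite /section_of_cocycle cocycle1 invg1. Qed.

Lemma section_of_cocycleM c : {morph section_of_cocycle c : a b / a * b}.
Proof.
by move=> a b; rewrite sdp_mulE /section_of_cocycle /= -cocycleM invgM gmulfV.
Qed.

HB.instance Definition _ c :=
  isUMagmaMorphism.Build G (sdp L) (section_of_cocycle c)
    (section_of_cocycle1 c, section_of_cocycleM c).

Definition splitting_of_cocycle c : splitting L :=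
  @MkSplitting G N L (section_of_cocycle c) (fun=> erefl).

Lemma cocycle_of_splittingK : cancel cocycle_of_splitting splitting_of_cocycle.
Proof.
move=> s; apply: splitting_ext => g; rewrite [RHS]splitting_eta /=.
by rewrite /section_of_cocycle /= invgK.
Qed.

Lemma splitting_of_cocycleK : cancel splitting_of_cocycle cocycle_of_splitting.
Proof. by move=> c; apply: cocycle_ext => g /=; rewrite invgK. Qed.

Lemma conj_splittingE s n g :
  sdp_incl L n * s g * (sdp_incl L n)^-1 = (n * (s g).1 * (L g n)^-1, g).
Proof.
by rewrite !sdp_mulE /= invg1 !act1 splitting2 mul1g mulg1 gmulfV.
Qed.

(** Both relations, for the same [n], say that
    [(s2 g).1 = n * (s1 g).1 * (L g n)^-1]. *)
Lemma cohomologous_cocycle_of_splitting s1 s2 :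
  cohomologous (cocycle_of_splitting s1) (cocycle_of_splitting s2) <->
  N_conjugate s1 s2.
Proof.
split=> -[n E]; exists n => g; move: (E g); rewrite conj_splittingE /=.
- move=> Eg; rewrite splitting_eta; congr (_, _).
  by apply: (canRL (mulgK _)); apply: (mulIg (s1 g).1^-1);
     rewrite -mulgA Eg mulVKg mulgK.
- by move=> ->; rewrite /= !invgM invgK !mulgA mulgVK.
Qed.

End SplittingsAndCocycles.

Theorem theorem5p5 (G N : groupType) (L : {ghom G -> aut N}) :
  exists f : splitting_classes L -> H1 L, bijective f.
Proof.
apply: (eq_quot_bij (@cocycle_of_splittingK _ _ L)
                    (@splitting_of_cocycleK _ _ L)) => s1 s2.
by apply: asbool_equiv_eq; apply: cohomologous_cocycle_of_splitting.
Qed.
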